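(* Consider $\ddot x=-\nabla\phi(x)$, $x\in\mathbf{R}^{N}$, with Lagrangian $L(x,\dot x)=\frac12\dot x^\top\dot x-\phi(x)$, and a splitting $\phi=\sum_{i=1}^{N}\phi^{[i]}$. Let $$\mathbb{L}^{\text{1st}}(x_n,x_{n+1},h)=\frac12\frac{(x_{n+1}-x_n)^\top(x_{n+1}-x_n)}{h^2}-\sum_{i=1}^{N}\phi^{[i]}(\widehat x_n^{\,i}),\qquad \widehat x_n^{\,i}=x_n+\sum_{j=1}^{i}(x_{n+1}^j-x_n^j)\mathbf{e}_j .$$ Then the discrete Lagrangian $\mathbb{L}^{\text{1st}}$ is of order $1$. Moreover, the discrete Euler–Lagrange equations induced by $\mathbb{L}^{\text{1st}}$ are $$\frac{x_{n+1}^1-2x_n^1+x_{n-1}^1}{h^2}=-\frac{\partial}{\partial x_1}\Big(\sum_{j=1}^{N}\phi^{[j]}(\widehat x_{n-1}^{\,j})\Big),$$ $$\frac{x_{n+1}^i-2x_n^i+x_{n-1}^i}{h^2}=-\frac{\partial}{\partial x_i}\Big(\sum_{j=1}^{i-1}\phi^{[j]}(\widehat x_n^{\,j})+\sum_{j=i}^{N}\phi^{[j]}(\widehat x_{n-1}^{\,j})\Big),\quad i=2,\dots,N,$$ and this integrator is equivalent to the symplectic method $\Phi_h=\Phi^h_{H_N}\circ\cdots\circ\Phi^h_{H_1}$, where $\Phi^h_{H_i}:(x_n,p_n)\mapsto(x_{n+1},p_{n+1})$ is $$x_{n+1}=x_n+h\,p_n^i\,\mathbf{e}_i,\qquad p_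{n+1}=p_n-h\nabla\phi^{[i]}(x_{n+1}).$$
   Context: Functions $\phi^{[i]}$ are smooth. Subscripts on points denote the time index, superscripts denote components; $\mathbf{e}_j$ is the $j$-th standard basis vector. $\frac{\partial}{\partial x_i}\phi^{[j]}(\widehat x)$ means the partial derivative $\partial_i\phi^{[j]}$ evaluated at $\widehat x$. $\Phi^h_{H_i}$ is the symplectic Euler map for $H^{[i]}(x,p)=\frac12p_i^2+\phi^{[i]}(x)$, where $H(x,p)=\frac12p^\top p+\phi(x)=\sum_iH^{[i]}$. A discrete Lagrangian $\mathbb{L}$ approximates the action: $h\mathbb{L}(x_n,x_{n+1},h)\approx\int_{t_n}^{t_{n+1}}L(x,\dot x)\,dt$, with $t_{n+1}=t_n+h$. It is of order $r$ if $h\mathbb{L}(x(t_n),x(t_{n+1}),h)=\int_{t_n}^{t_{n+1}}L(x,\dot x)\,dt+\mathcal{O}(h^{r+1})$ for smooth solutions $x(t)$. The discrete Euler–Lagrange equations are $\partial_1\mathbb{L}(x_n,x_{n+1},h)+\partial_2\mathbb{L}(x_{n-1},x_n,h)=0$. The discrete Legendre transforms define momenta $p_n=-h\,\partial_1\mathbb{L}(x_n,x_{n+1},h)$ and $p_{n+1}=h\,\partial_2\mathbb{L}(x_n,x_{n+1},h)$. The variational integrator is equivalent to a one-step map $\Phi_h$ if these relations define precisely the map $(x_n,p_n)\mapsto(x_{n+1},p_{n+1})=\Phi_h(x_n,p_n)$. *)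

(* Defs.v *)
From HB Require Import structures.
From mathcomp Require Import all_boot all_order all_algebra.
From mathcomp Require Import all_classical all_reals all_analysis.

Set Implicit Arguments.
Unset Strict Implicit.
Unset Printing Implicit Defensive.
Import Order.TTheory GRing.Theory Num.Theory.
Import numFieldNormedType.Exports.

Local Open Scope classical_set_scope.
Local Open Scope ring_scope.

(* Points of R^N are row vectors ['rV[R]_N]; the component x^i is [x 0 i].
   Components are numbered from 0, so x^1 is [x 0 i] with [i = 0 :> nat]. *)

Section Calculus.
Context {R : realType} {N : nat}.
Implicit Types (f : 'rV[R]_N -> R) (x u v : 'rV[R]_N) (i : 'I_N).

Definition basis i : 'rV[R]_N := delta_mx 0 i.

Definition dotp u v : R := (u *m v^T) 0 0.

Definition partial i f : 'rV[R]_N -> R := fun x => 'D_(basis i) f x.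

Definition grad f x : 'rV[R]_N := \row_i partial i f x.

(* Infinite differentiability: all iterated partial derivatives, [f] itself
   included ([s = [::]]), are (Frechet) differentiable everywhere. *)
Definition smooth f : Prop :=
  forall (s : seq 'I_N) x, differentiable (foldr partial f s) x.

(* A smooth solution of x'' = - grad phi (x) on the open interval ]T0, T1[. *)
Definition smooth_solution (phi : 'rV[R]_N -> R) (T0 T1 : R)
    (x : R -> 'rV[R]_N) : Prop :=
  forall t, T0 < t -> t < T1 ->
    (forall k, derivable (x^`(k))%classic t 1) /\ (x^`(2))%classic t = - grad phi (x t).

End Calculus.

Section DiscreteMechanics.
Context {R : realType} {N : nat}.
Implicit Types (x y p q u v : 'rV[R]_N) (h t : R).

Definition lagrangian (phi : 'rV[R]_N -> R) x v : R :=
  2^-1 * dotp v v - phi x.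

(* [LL x y h] is the value of a discrete Lagrangian at (x_n, x_{n+1}, h). *)
Implicit Type LL : 'rV[R]_N -> 'rV[R]_N -> R -> R.

Definition grad1 LL x y h : 'rV[R]_N := grad (fun u => LL u y h) x.
Definition grad2 LL x y h : 'rV[R]_N := grad (fun u => LL x u h) y.

(* The constant in O(h^{r+1}) depends on the solution and is uniform for the
   initial time t in compact subintervals [a, b] of its interval of definition;
   [a = b] is the estimate at a fixed time. *)
Definition discrete_lagrangian_order (phi : 'rV[R]_N -> R) LL (r : nat) : Prop :=
  forall (T0 T1 : R) (x : R -> 'rV[R]_N), smooth_solution phi T0 T1 x ->
  forall a b : R, T0 < a -> a <= b -> b < T1 ->
  exists C h0 : R, 0 < h0 /\
    forall t h, a <= t -> t <= b -> 0 < h -> h <= h0 ->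
      `| h * LL (x t) (x (t + h)) h
         - \int[lebesgue_measure]_(s in `[t, t + h])
             lagrangian phi (x s) ((x^`())%classic s) | <= C * h ^+ r.+1.

(* [xm], [x], [xp] are three consecutive points x_{n-1}, x_n, x_{n+1}. *)
Definition discrete_euler_lagrange LL h xm x xp : Prop :=
  grad1 LL x xp h + grad2 LL xm x h = 0.

Definition legendre_momenta LL h x p y q : Prop :=
  p = - (h *: grad1 LL x y h) /\ q = h *: grad2 LL x y h.

Definition equivalent_one_step LL h
    (Phi : 'rV[R]_N * 'rV[R]_N -> 'rV[R]_N * 'rV[R]_N) : Prop :=
  forall x p y q, legendre_momenta LL h x p y q <-> (y, q) = Phi (x, p).

End DiscreteMechanics.

Section Symplectic.
Context {R : realType} {N : nat}.
Notation phase := ('rV[R]_N * 'rV[R]_N)%type.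

Definition sympl_form (z w : phase) : R := dotp z.1 w.2 - dotp z.2 w.1.

Definition symplectic_map (F : phase -> phase) : Prop :=
  forall z, differentiable F z /\
    forall u v, sympl_form ('d F z u) ('d F z v) = sympl_form u v.

(* The variant of symplectic Euler that is implicit in x and explicit in p. *)
Definition symplectic_euler (H : 'rV[R]_N -> 'rV[R]_N -> R) (h : R)
    (z z' : phase) : Prop :=
  z'.1 = z.1 + h *: grad (fun p => H z'.1 p) z.2 /\
  z'.2 = z.2 - h *: grad (fun x => H x z.2) z'.1.

End Symplectic.

Section Method.
Context {R : realType} {N : nat}.
Variable phis : 'I_N -> 'rV[R]_N -> R.
Implicit Types (x y p : 'rV[R]_N) (h : R) (i : 'I_N).

Definition xhat x y i : 'rV[R]_N :=
  x + \sum_(j < N | (j <= i)%N) (y 0 j - x 0 j) *: basis j.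

Definition L1st x y h : R :=
  2^-1 * (dotp (y - x) (y - x) / h ^+ 2) - \sum_(i < N) phis i (xhat x y i).

Definition Hsplit i x p : R := 2^-1 * p 0 i ^+ 2 + phis i x.

Definition split_step h (z : 'rV[R]_N * 'rV[R]_N) i : 'rV[R]_N * 'rV[R]_N :=
  let x' := z.1 + (h * z.2 0 i) *: basis i in
  (x', z.2 - h *: grad (phis i) x').

(* [foldl] applies the step of the first index first. *)
Definition split_method h (z : 'rV[R]_N * 'rV[R]_N) : 'rV[R]_N * 'rV[R]_N :=
  foldl (split_step h) z (enum 'I_N).

End Method.

(* Main.v *)
Require Import Defs.
From HB Require Import structures.
From mathcomp Require Import all_boot all_order all_algebra.
From mathcomp Require Import all_classical all_reals all_analysis.
From mathcomp Require Import ring lra.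

Set Implicit Arguments.
Unset Strict Implicit.
Unset Printing Implicit Defensive.
Import Order.TTheory GRing.Theory Num.Theory.
Import numFieldNormedType.Exports.

Local Open Scope classical_set_scope.
Local Open Scope ring_scope.

(** The whole theorem hangs on the shape of the intermediate points: xhat x y j
has the components of y up to index j and those of x afterwards ([xhatE]).  So
moving y along e_i moves xhat x y j along e_i exactly when i <= j, and moving x
along e_i does so exactly when j < i.  Differentiating the discrete Lagrangian
along such lines gives its two gradients ([grad1_L1st], [grad2_L1st]); their sum
is the discrete Euler-Lagrange system, and since no j is smaller than the first
index, the equation for that index involves the older points only.

The Legendre relations, solved for y and q, become
    y_i = x_i + h (p_i - h sum_(j < i) d_i phis_j (xhat x y j)),
    q   = p - h sum_j grad phis_j (xhat x y j).
The points xhat x y j with j < i depend on the components y_k with k < i only, so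
the first line is a triangular system with exactly one solution
([triangular_uniq]).  The split method solves it: step i changes only the
component i of the position, hence the position reached after step j is
xhat x y j for the final position y ([split_state_xhat]), and the momentum has by
then lost h grad phis_j (xhat x y j) for every step made so far
([split_state_mom]).

A split step is a drift along e_i followed by a kick by a gradient.  Its
differential preserves the symplectic form because the Hessian of a smooth
function is symmetric ([partial_sym]), which is obtained by evaluating a second
difference with the mean value theorem in either order of the two directions.
Symplectic maps compose, so the split method is symplectic.

For the order, fix a compact time interval on which the solution and its first
two derivatives are bounded.  At any time s in [t, t + h] the integrand
L (x s, x' s) differs from the discrete Lagrangian by O(h): the components of
the difference quotient are those of x' at nearby times, the points xhat lie
within O(h) of x s, and each phis_j is Lipschitz on balls
([discrete_lagrangian_pointwise]).  Integrating over an interval of length h gives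
an error O(h^2). *)

(* Topology has a predicate of the same name, on bases of neighbourhoods, which
   would hide the unit vectors. *)
Local Notation basis := Defs.basis.

(** * Directional derivatives and symmetry of the Hessian *)

Section Calculus.
Context {R : realType} {N : nat}.
Implicit Types (f : 'rV[R]_N -> R) (x u v : 'rV[R]_N) (i : 'I_N).

Lemma basisE i k : (basis i : 'rV[R]_N) 0 k = (k == i)%:R.
Proof. by rewrite /basis mxE eqxx. Qed.

Lemma scale_basisE (c : R) i k :
  (c *: (basis i : 'rV[R]_N)) 0 k = c * (k == i)%:R.
Proof. by rewrite mxE basisE. Qed.

Lemma add_basisE x (c : R) i k :
  (x + c *: basis i) 0 k = x 0 k + c * (k == i)%:R.
Proof. by rewrite mxE scale_basisE. Qed.

Lemma dotpE u v : dotp u v = \sum_k u 0 k * v 0 k.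
Proof. by rewrite /dotp mxE; apply: eq_bigr => k _; rewrite mxE. Qed.

(** Both sides are limits of the same difference quotients; this reduces the
directional derivatives below to derivatives in one real variable. *)
Lemma is_derive_lineP f x v (t df : R) :
  is_derive (x + t *: v) v f df <-> is_derive t 1 (fun s => f (x + s *: v)) df.
Proof.
have E : (fun h : R => h^-1 *: ((f \o shift (x + t *: v)) (h *: v)
             - f (x + t *: v)))
       = (fun h : R => h^-1 *: (((fun s => f (x + s *: v)) \o shift t) (h *: 1)
             - f (x + t *: v))).
  apply/funext => h /=; congr (_ *: (f _ - _)).
  by rewrite scalerDl [h *: 1]mulr1 addrCA.
split=> -[d1 d2].
- by split; rewrite /derivable/derive -?E.
- by split; rewrite /derivable/derive ?E.
Qed.

Lemma derive_partials f x v : differentiable f x ->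
  'D_v f x = \sum_i v 0 i * partial i f x.
Proof.
move=> df; rewrite deriveE// [in LHS](row_sum_delta v) linear_sum/=.
by apply: eq_bigr => i _; rewrite linearZ/= /partial deriveE.
Qed.

Lemma coord_diff (i : 'I_N) x v : 'd (fun y : 'rV[R]_N => y 0 i : R) x v = v 0 i.
Proof.
rewrite -deriveE; last exact: differentiable_coord.
have := derive_mx (@derivable_id _ _ x v).
by rewrite derive_id => /rowP/(_ i); rewrite mxE.
Qed.

(** A row-valued map is the sum of its components times the basis vectors, which
turns differentiability into a statement on scalar functions. *)
Lemma is_diff_row (V : normedModType R) (F : V -> 'rV[R]_N) z
    (dF : 'I_N -> V -> R) :
  (forall k, is_diff z (fun y => F y 0 k) (dF k)) ->
  is_diff z F (fun w => \row_k dF k w).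
Proof.
move=> Fk.
have FE : F = \sum_(k < N) (fun y => F y 0 k *: basis k).
  by apply/funext => y; rewrite [LHS]row_sum_delta fct_sumE.
have dFk (k : 'I_N) : is_diff z (fun y => F y 0 k *: basis k)
    (fun w => dF k w *: basis k).
  have d := (@is_diff_scalel R _ (F z 0 k) (basis k : 'rV[R]_N)).
  exact: (is_diff_comp (Fk k) d).
have [dF1 dF2] : is_diff z F (\sum_(k < N) (fun w => dF k w *: basis k)).
  rewrite FE; elim/big_ind2: _ => [|f1 a f2 b H1 H2|k _]; last exact: dFk.
  - exact: is_diff_cst.
  - exact: is_diffD.
split=> //; rewrite dF2; apply/funext => w.
rewrite [RHS]row_sum_delta /basis.
by rewrite fct_sumE; apply: eq_bigr => k _; rewrite mxE.
Qed.

(** The mean value theorem is applied twice: to the increment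
t |-> f (x + s v + t u) - f (x + t u), then, in the direction v, to the derivative
of f along u.  The left-hand side is symmetric in u and v, whereas the right-hand
side is not. *)
Lemma second_difference f x u v (s : R) : 0 < s ->
  (forall y, differentiable f y) -> (forall y, differentiable ('D_u f) y) ->
  exists a b, [/\ 0 < a < s, 0 < b < s &
    f (x + s *: u + s *: v) - f (x + s *: u) - (f (x + s *: v) - f x) =
    s ^+ 2 * 'D_v ('D_u f) (x + a *: u + b *: v)].
Proof.
move=> s0 df dDf.
have dline (g : 'rV[R]_N -> R) y w (t : R) : (forall y, differentiable g y) ->
    is_derive t 1 (fun r => g (y + r *: w)) ('D_w g (y + t *: w)).
  by move=> dg; apply/is_derive_lineP/derivableP/diff_derivable/dg.
pose g (t : R) := f (x + s *: v + t *: u) - f (x + t *: u).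
have dg (t : R) : is_derive t 1 g
    ('D_u f (x + s *: v + t *: u) - 'D_u f (x + t *: u)).
  by apply: is_deriveB; apply: dline.
have cont (k : R -> R) (dk : R -> R) : (forall t : R, is_derive t 1 k (dk t)) ->
    {within `[0, s], continuous k}.
  move=> dk1; apply: continuous_subspaceT => t.
  by apply/differentiable_continuous/derivable1_diffP; case: (dk1 t).
have [a] := MVT s0 (fun t _ => dg t) (cont _ _ dg).
rewrite in_itv/= => a_s ga.
have dq (t : R) : is_derive t 1 (fun r => 'D_u f (x + a *: u + r *: v))
    ('D_v ('D_u f) (x + a *: u + t *: v)) by apply: dline.
have [b] := MVT s0 (fun t _ => dq t) (cont _ _ dq).
rewrite in_itv/= => b_s qb.
exists a, b; split=> //.
move: ga qb; rewrite /g !scale0r !addr0 !subr0 => ga qb.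
rewrite [x + s *: u + _]addrAC [RHS]mulrC expr2 mulrA -qb.
by rewrite [x + a *: u + _]addrAC -ga.
Qed.

Lemma eq_of_common_approx (A B : R) :
  (forall e, 0 < e -> exists P, `|A - P| < e /\ `|B - P| < e) -> A = B.
Proof.
move=> AB; apply/eqP; rewrite -subr_eq0 -normr_le0; apply/ler_addgt0Pl => e e0.
have [|P []] := AB (e / 2); first by lra.
by rewrite addr0 !ltr_norml ler_norml => /andP[? ?] /andP[? ?]; lra.
Qed.

(** Schwarz's theorem.  The second difference over a small parallelogram is
s^2 times a value of either mixed derivative at a nearby point, so both mixed
derivatives at x have a common approximation. *)
Lemma derive_sym f x u v :
  (forall y, differentiable f y) ->
  (forall y, differentiable ('D_u f) y) -> (forall y, differentiable ('D_v f) y) ->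
  {for x, continuous ('D_v ('D_u f))} -> {for x, continuous ('D_u ('D_v f))} ->
  'D_v ('D_u f) x = 'D_u ('D_v f) x.
Proof.
move=> df dfu dfv cvu cuv.
apply: eq_of_common_approx => e e0.
move/cvgrPdist_lt : cvu => /(_ _ e0) /nbhs_ballP [d1 /= d10 D1].
move/cvgrPdist_lt : cuv => /(_ _ e0) /nbhs_ballP [d2 /= d20 D2].
pose d := Num.min d1 d2; have d0 : 0 < d by rewrite lt_min d10.
(* The step s keeps the parallelogram in the ball of radius d; adding 1 covers
   u = v = 0. *)
pose m := `|u| + `|v| + 1.
have m0 : 0 < m by rewrite /m; have := normr_ge0 u; have := normr_ge0 v; lra.
pose s := d / m; have s0 : 0 < s by rewrite divr_gt0.
have near a b p q : 0 < a < s -> 0 < b < s -> `|p| + `|q| = `|u| + `|v| ->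
    ball x d (x + a *: p + b *: q).
  move=> /andP[a0 as_] /andP[b0 bs] pq.
  rewrite -ball_normE /= /ball_ /= -addrA opprD addrA subrr add0r normrN.
  apply: (le_lt_trans (ler_normD _ _)); rewrite !normrZ !gtr0_norm//.
  have pq0 : `|p| + `|q| < m by rewrite pq /m; lra.
  have -> : d = s * m by rewrite /s mulfVK// gt_eqF.
  have p0 := normr_ge0 p; have q0 := normr_ge0 q; nra.
have [a [b [as_ bs E1]]] := second_difference x v s0 df dfu.
have [a' [b' [as' bs' E2]]] := second_difference x u s0 df dfv.
have s2 : s ^+ 2 != 0 by rewrite expf_neq0// gt_eqF.
have comm : f (x + s *: u + s *: v) - f (x + s *: u) - (f (x + s *: v) - f x)
    = f (x + s *: v + s *: u) - f (x + s *: v) - (f (x + s *: u) - f x).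
  rewrite [x + s *: v + _]addrAC.
  by rewrite !opprB addrACA [RHS]addrACA [- _ - _ in LHS]addrC.
have E := mulfI s2 (etrans (esym E1) (etrans comm E2)).
exists ('D_v ('D_u f) (x + a *: u + b *: v)); split.
  by apply/D1/(@le_ball _ _ _ d); [rewrite ge_min lexx|exact: near].
apply: (eq_ind_r (fun z => `|_ - z| < e) _ E).
apply/D2/(@le_ball _ _ _ d); first by rewrite ge_min lexx orbT.
exact: (near _ _ v u as' bs' (addrC _ _)).
Qed.

Lemma smooth_partial f i : smooth f -> smooth (partial i f).
Proof. by move=> sf s x; rewrite -foldr_rcons; apply: sf. Qed.

Lemma smooth_differentiable f x : smooth f -> differentiable f x.
Proof. by move/(_ [::]); apply. Qed.

Lemma smooth_continuous f : smooth f -> continuous f.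
Proof. by move=> sf x; apply/differentiable_continuous/smooth_differentiable. Qed.

Lemma partial_sym f i j x : smooth f ->
  partial i (partial j f) x = partial j (partial i f) x.
Proof.
move=> sf; apply: derive_sym.
- by move=> y; apply: smooth_differentiable.
- by move=> y; apply: (smooth_differentiable _ (smooth_partial _ sf)).
- by move=> y; apply: (smooth_differentiable _ (smooth_partial _ sf)).
- exact: (smooth_continuous (smooth_partial _ (smooth_partial _ sf))).
- exact: (smooth_continuous (smooth_partial _ (smooth_partial _ sf))).
Qed.

End Calculus.

(** * Gradients of the discrete Lagrangian *)

Section DiscreteLagrangian.
Context {R : realType} {N : nat}.
Variable phis : 'I_N -> 'rV[R]_N -> R.
Implicit Types (x y p q : 'rV[R]_N) (h : R) (i j k : 'I_N).

Lemma sum_basisE (P : pred 'I_N) (c : 'I_N -> R) k :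
  (\sum_(j | P j) c j *: (basis j : 'rV[R]_N)) 0 k = if P k then c k else 0.
Proof.
rewrite summxE; under eq_bigr do rewrite scale_basisE.
rewrite big_mkcond (bigD1 k)//= big1 ?addr0 ?eqxx ?mulr1// => j jk.
by rewrite eq_sym (negPf jk) mulr0 if_same.
Qed.

Lemma xhatE x y j k : xhat x y j 0 k = if (k <= j)%N then y 0 k else x 0 k.
Proof.
by rewrite /xhat mxE sum_basisE; case: ifP => _; rewrite ?addr0// addrC subrK.
Qed.

Lemma xhat_line_r x y i j (t : R) :
  xhat x (y + t *: basis i) j = xhat x y j + (if (i <= j)%N then t else 0) *: basis i.
Proof.
apply/rowP => k; rewrite [RHS]add_basisE !xhatE add_basisE.
have [->|ki] := eqVneq k i; first by case: ifP; rewrite ?mul0r ?addr0.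
by rewrite !mulr0 !addr0.
Qed.

Lemma xhat_line_l x y i j (t : R) :
  xhat (x + t *: basis i) y j = xhat x y j + (if (j < i)%N then t else 0) *: basis i.
Proof.
apply/rowP => k; rewrite [RHS]add_basisE !xhatE add_basisE ltnNge.
have [->|ki] := eqVneq k i; first by case: ifP; rewrite ?mul0r ?addr0.
by rewrite !mulr0 !addr0.
Qed.

Lemma is_derive_quadratic (a b c : R) :
  is_derive (0 : R) 1 (fun t => a + b * t + c * t ^+ 2) b.
Proof.
have E : (fun t => a + b * t + c * t ^+ 2) = cst a + b \*: id + c \*: (id ^+ 2) by [].
rewrite E.
have d1 : is_derive (0 : R) (1 : R) id (1 : R) by exact: is_derive_id.
have d := is_deriveD (is_deriveD (is_derive_cst a (0 : R) (1 : R))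
  (is_deriveZ b d1)) (is_deriveZ c (is_deriveX 2 d1)).
apply: (is_derive_eq d).
by rewrite expr1 mulr0 scale0r scaler0 addr0 add0r [_ *: _]mulr1.
Qed.

Hypothesis phis_diff : forall j x, differentiable (phis j) x.

(** The common form of the discrete Lagrangian along a line in either argument:
d is the displacement y - x, e = 1 or -1 its rate along e_i, X j the intermediate
points and c j tells whether X j moves with the parameter. *)
Lemma is_derive_L1st_line i (c : pred 'I_N) (X : 'I_N -> 'rV[R]_N)
    (d : 'rV[R]_N) (e h : R) :
  is_derive (0 : R) 1 (fun t : R =>
    2^-1 * (dotp (d + (t * e) *: basis i) (d + (t * e) *: basis i) / h ^+ 2)
    - \sum_j phis j (X j + (if c j then t else 0) *: basis i))
  (e * d 0 i / h ^+ 2 - \sum_(j | c j) partial i (phis j) (X j)).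
Proof.
have quad (t : R) :
    2^-1 * (dotp (d + (t * e) *: basis i) (d + (t * e) *: basis i) / h ^+ 2)
    = 2^-1 * (dotp d d / h ^+ 2) + e * d 0 i / h ^+ 2 * t
      + 2^-1 * e ^+ 2 / h ^+ 2 * t ^+ 2.
  have -> : dotp (d + (t * e) *: basis i) (d + (t * e) *: basis i)
      = dotp d d + 2 * (t * e * d 0 i) + (t * e) ^+ 2.
    rewrite !dotpE (bigD1 i)//= [in RHS](bigD1 i)//= !add_basisE eqxx mulr1.
    rewrite (eq_bigr (fun k => d 0 k * d 0 k)) => [|k ki]; first by ring.
    by rewrite !add_basisE (negPf ki) mulr0 addr0.
  by move: (h ^+ 2)^-1 => w; field.
rewrite (_ : (fun t : R => _) =
    (fun t => 2^-1 * (dotp d d / h ^+ 2) + e * d 0 i / h ^+ 2 * t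
      + 2^-1 * e ^+ 2 / h ^+ 2 * t ^+ 2)
    - \sum_j (fun t => phis j (X j + (if c j then t else 0) *: basis i))); last first.
  by apply/funext => t; rewrite quad fctE fct_sumE.
apply: is_deriveB; first exact: is_derive_quadratic.
rewrite [X in is_derive _ _ _ X]big_mkcond/=; apply: is_derive_sum => j.
case: (c j); last exact: is_derive_cst.
apply/is_derive_lineP; rewrite scale0r addr0.
exact/derivableP/diff_derivable/phis_diff.
Qed.

Lemma grad1_L1st x y h i : grad1 (L1st phis) x y h 0 i =
  - ((y 0 i - x 0 i) / h ^+ 2)
  - \sum_(j < N | (j < i)%N) partial i (phis j) (xhat x y j).
Proof.
have := is_derive_L1st_line i (fun j : 'I_N => j < i)%N (xhat x y) (y - x) (-1) h.
rewrite !mxE mulN1r mulNr.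
rewrite [X in is_derive _ _ X](_ : _ =
    (fun t : R => L1st phis (x + t *: basis i) y h)); last first.
  apply/funext => t; rewrite /L1st; congr (_ * (_ / _) - _).
    by rewrite mulrN1 scaleNr opprD addrA.
  by apply: eq_bigr => j _; rewrite xhat_line_l.
by move/(is_derive_lineP (fun u => L1st phis u y h)); rewrite scale0r addr0 => -[].
Qed.

Lemma grad2_L1st x y h i : grad2 (L1st phis) x y h 0 i =
  (y 0 i - x 0 i) / h ^+ 2
  - \sum_(j < N | (i <= j)%N) partial i (phis j) (xhat x y j).
Proof.
have := is_derive_L1st_line i (fun j : 'I_N => i <= j)%N (xhat x y) (y - x) 1 h.
rewrite !mxE mul1r.
rewrite [X in is_derive _ _ X](_ : _ =
    (fun t : R => L1st phis x (y + t *: basis i) h)); last first.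
  apply/funext => t; rewrite /L1st; congr (_ * (_ / _) - _).
    by rewrite mulr1 addrAC.
  by apply: eq_bigr => j _; rewrite xhat_line_r.
by move/(is_derive_lineP (fun u => L1st phis x u h)); rewrite scale0r addr0 => -[].
Qed.

(** At the first index the sum over j < i is empty, so this single system contains
both families of equations of the theorem. *)
Lemma discrete_euler_lagrangeP h xm x xp :
  discrete_euler_lagrange (L1st phis) h xm x xp <->
  forall i, (xp 0 i - 2 * x 0 i + xm 0 i) / h ^+ 2 =
    - (\sum_(j < N | (j < i)%N) partial i (phis j) (xhat x xp j)
       + \sum_(j < N | (i <= j)%N) partial i (phis j) (xhat xm x j)).
Proof.
have coord i : (grad1 (L1st phis) x xp h + grad2 (L1st phis) xm x h) 0 i
    = - ((xp 0 i - 2 * x 0 i + xm 0 i) / h ^+ 2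
      + (\sum_(j < N | (j < i)%N) partial i (phis j) (xhat x xp j)
         + \sum_(j < N | (i <= j)%N) partial i (phis j) (xhat xm x j))).
  by rewrite mxE grad1_L1st grad2_L1st; ring.
rewrite /discrete_euler_lagrange; split=> [E i|E].
  by move/rowP: E => /(_ i); rewrite coord mxE => /eqP; rewrite oppr_eq0 addr_eq0 => /eqP.
by apply/rowP => i; rewrite coord mxE E addNr oppr0.
Qed.

(** The first relation gives (y - x) / h; substituting it in the second one merges
the sums over j < i and over i <= j into a sum over all j. *)
Lemma legendre_momentaP h x p y q : h != 0 ->
  legendre_momenta (L1st phis) h x p y q <->
  (forall i, y 0 i = x 0 i
     + h * (p 0 i - h * \sum_(j < N | (j < i)%N) partial i (phis j) (xhat x y j)))
  /\ q = p - h *: \sum_j grad (phis j) (xhat x y j).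
Proof.
move=> h0; rewrite /legendre_momenta.
have pE i : (- (h *: grad1 (L1st phis) x y h)) 0 i = (y 0 i - x 0 i) / h
    + h * \sum_(j < N | (j < i)%N) partial i (phis j) (xhat x y j).
  by rewrite mxE [X in - X]mxE grad1_L1st; field.
have qE i : (h *: grad2 (L1st phis) x y h) 0 i = (y 0 i - x 0 i) / h
    - h * \sum_(j < N | (i <= j)%N) partial i (phis j) (xhat x y j).
  by rewrite mxE grad2_L1st; field.
have sumE i : \sum_j partial i (phis j) (xhat x y j)
    = \sum_(j < N | (j < i)%N) partial i (phis j) (xhat x y j)
      + \sum_(j < N | (i <= j)%N) partial i (phis j) (xhat x y j).
  rewrite (bigID (fun j : 'I_N => (j < i)%N))/=; congr (_ + _).
  by apply: eq_bigl => j; rewrite -leqNgt.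
have gE i : (p - h *: \sum_j grad (phis j) (xhat x y j)) 0 i
    = p 0 i - h * (\sum_(j < N | (j < i)%N) partial i (phis j) (xhat x y j)
      + \sum_(j < N | (i <= j)%N) partial i (phis j) (xhat x y j)).
  by rewrite !mxE summxE -sumE; congr (_ - _ * _); apply: eq_bigr => j _; rewrite mxE.
split=> [[/rowP pL /rowP qL]|[yE ->]].
  split=> [i|]; first by rewrite pL pE; field.
  by apply/rowP => i; rewrite gE qL qE pL pE; ring.
split; apply/rowP => i; rewrite ?pE ?gE ?qE yE; by field.
Qed.

End DiscreteLagrangian.

(** * The split method solves the Legendre relations *)

Section SplitMethod.
Context {R : realType} {N : nat}.
Variable phis : 'I_N -> 'rV[R]_N -> R.
Implicit Types (x y p q : 'rV[R]_N) (h : R) (i j k : 'I_N).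

(** Forward substitution. *)
Lemma triangular_uniq (F : 'I_N -> 'rV[R]_N -> R) :
  (forall i y y', (forall k, (k < i)%N -> y 0 k = y' 0 k) -> F i y = F i y') ->
  forall y y', (forall i, y 0 i = F i y) -> (forall i, y' 0 i = F i y') -> y = y'.
Proof.
move=> Fi y y' yF y'F; apply/rowP.
suff agree n : forall i : 'I_N, (i < n)%N -> y 0 i = y' 0 i.
  by move=> i; apply: (agree N).
elim: n => // n IH i; rewrite ltnS => i_n.
by rewrite yF y'F; apply: Fi => k ki; apply: IH; apply: leq_trans i_n.
Qed.

Definition split_state h z n := foldl (split_step phis h) z (take n (enum 'I_N)).

Lemma split_stateS h z i :
  split_state h z i.+1 = split_step phis h (split_state h z i) i.
Proof.
rewrite /split_state (take_nth i) ?size_enum_ord// -cats1 foldl_cat/=.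
by rewrite nth_ord_enum.
Qed.

Lemma split_state_full h z : split_state h z N = split_method phis h z.
Proof. by rewrite /split_state -[X in take X]size_enum_ord take_size. Qed.

(** Step k is the only one that changes the component k of the position, and it
uses the momentum available just before it. *)
Lemma split_state_pos h z n k : (n <= N)%N -> (split_state h z n).1 0 k =
  if (k < n)%N then z.1 0 k + h * (split_state h z k).2 0 k else z.1 0 k.
Proof.
elim: n => [|n IH] nN; first by rewrite /split_state take0.
pose i := Ordinal nN; rewrite -[n.+1]/(i.+1) split_stateS /= add_basisE.
rewrite IH ?(ltnW nN)// ltnS [in RHS]leq_eqVlt -[k == n :> nat]/(k == i).
have [->|ki] := eqVneq k i; first by rewrite ltnn mulr1.
by rewrite mulr0 addr0.
Qed.

(** This is why the intermediate points of the discrete Lagrangian have their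
form: the potential phis i is sampled where the splitting evaluates its
gradient. *)
Lemma split_state_xhat h z i :
  (split_state h z i.+1).1 = xhat z.1 (split_method phis h z).1 i.
Proof.
apply/rowP => k; rewrite -split_state_full xhatE !split_state_pos//.
by rewrite ltnS ltn_ord.
Qed.

Lemma split_state_mom h z n : (n <= N)%N -> (split_state h z n).2 =
  z.2 - h *: \sum_(j < N | (j < n)%N)
               grad (phis j) (xhat z.1 (split_method phis h z).1 j).
Proof.
elim: n => [|n IH] nN.
  by rewrite /split_state take0 big_pred0// scaler0 subr0.
pose i := Ordinal nN; rewrite -[n.+1]/(i.+1).
have -> : (split_state h z i.+1).2 = (split_state h z i).2
    - h *: grad (phis i) (split_state h z i.+1).1 by rewrite split_stateS.
rewrite split_state_xhat IH ?(ltnW nN)// [in RHS](bigD1 i)//= scalerDr opprD.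
rewrite addrA addrAC; congr (_ - _ *: _ - _); apply: eq_bigl => j.
by rewrite ltnS ltn_neqAle andbC.
Qed.

Hypothesis phis_diff : forall j x, differentiable (phis j) x.

Lemma split_method_legendre h z : h != 0 ->
  legendre_momenta (L1st phis) h z.1 z.2
    (split_method phis h z).1 (split_method phis h z).2.
Proof.
move=> h0; apply/legendre_momentaP => //; split.
  move=> i; rewrite -{1}split_state_full split_state_pos// ltn_ord.
  rewrite split_state_mom 1?ltnW//; congr (_ + _ * _).
  rewrite !mxE summxE; congr (_ - _ * _).
  by apply: eq_bigr => j _; rewrite mxE.
rewrite -{1}split_state_full split_state_mom//; congr (_ - _ *: _).
by apply: eq_bigl => j; rewrite ltn_ord.
Qed.

(** The split method yields a solution of the Legendre relations; triangularity
makes it the only one. *)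
Lemma split_method_equivalent h : h != 0 ->
  equivalent_one_step (L1st phis) h (split_method phis h).
Proof.
move=> h0 x p y q; split=> [leg|E]; last first.
  by have := split_method_legendre (x, p) h0; rewrite -E.
have /(legendre_momentaP phis_diff _ _ _ _ h0) := split_method_legendre (x, p) h0.
move: leg => /(legendre_momentaP phis_diff _ _ _ _ h0).
case: (split_method _ _ _) => y' q' /= [yE ->] [y'E ->].
suff -> : y = y' by [].
pose F (i : 'I_N) u := x 0 i
  + h * (p 0 i - h * \sum_(j < N | (j < i)%N) partial i (phis j) (xhat x u j)).
apply: (@triangular_uniq F _ _ _ yE y'E) => i u v uv; rewrite /F.
congr (_ + _ * (_ - _ * _)); apply: eq_bigr => j ji; congr (partial _ _ _).
apply/rowP => k; rewrite !xhatE; case: ifP => // kj.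
by apply: uv; apply: leq_ltn_trans ji.
Qed.

Lemma symplectic_eulerP h i z z' : (forall x, differentiable (phis i) x) ->
  symplectic_euler (Hsplit phis i) h z z' <-> z' = split_step phis h z i.
Proof.
move=> di.
have gradp x p : grad (fun p => Hsplit phis i x p) p = p 0 i *: basis i.
  apply/rowP => k; rewrite mxE scale_basisE /partial.
  suff : is_derive p (basis k) (Hsplit phis i x) (p 0 i * (k == i)%:R) by case.
  rewrite -[X in is_derive X](_ : p + 0 *: basis k = p); last first.
    by rewrite scale0r addr0.
  apply/is_derive_lineP.
  rewrite (_ : (fun s : R => _) = (fun s => (2^-1 * p 0 i ^+ 2 + phis i x)
      + p 0 i * (k == i)%:R * s + 2^-1 * (k == i)%:R * s ^+ 2)).
    exact: is_derive_quadratic.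
  apply/funext => s; rewrite /Hsplit add_basisE eq_sym.
  by case: eqP => _ /=; [rewrite mulr1n|rewrite mulr0n]; field.
have gradx x p : grad (fun x => Hsplit phis i x p) x = grad (phis i) x.
  apply/rowP => k; rewrite !mxE /partial /Hsplit.
  have [_ E] := is_deriveD (is_derive_cst (2^-1 * p 0 i ^+ 2) x (basis k))
    (derivableP (diff_derivable (v := basis k) (di x))).
  by rewrite -[RHS]add0r -E.
rewrite /symplectic_euler gradp gradx scalerA; case: z' => x' p'.
by split=> [/= [-> ->]|[-> ->]].
Qed.

End SplitMethod.

(** * Symplecticity *)

Section Symplecticity.
Context {R : realType} {N : nat}.
Notation phase := ('rV[R]_N * 'rV[R]_N)%type.
Implicit Types (x y p q : 'rV[R]_N) (z w : phase) (h : R) (i j k : 'I_N).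

Lemma is_diff_fst z : is_diff z (fst : phase -> _) (fst : phase -> _).
Proof.
have c : continuous (fst : phase -> 'rV[R]_N) by move=> ?; exact: cvg_fst.
split; first exact: (@linear_differentiable R _ _ fst z c).
exact: (@diff_lin R _ _ fst z c).
Qed.

Lemma is_diff_snd z : is_diff z (snd : phase -> _) (snd : phase -> _).
Proof.
have c : continuous (snd : phase -> 'rV[R]_N) by move=> ?; exact: cvg_snd.
split; first exact: (@linear_differentiable R _ _ snd z c).
exact: (@diff_lin R _ _ snd z c).
Qed.

Lemma is_diff_partials (f : 'rV[R]_N -> R) x : differentiable f x ->
  is_diff x f (fun v => \sum_l v 0 l * partial l f x).
Proof.
move=> df; split=> //; apply/funext => v.
by rewrite -derive_partials// deriveE.
Qed.

Lemma is_diff_grad (f : 'rV[R]_N -> R) x : smooth f ->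
  is_diff x (grad f) (fun v => \row_k \sum_l v 0 l * partial l (partial k f) x).
Proof.
move=> sf; apply: is_diff_row => k.
rewrite (_ : (fun y => _) = partial k f); last by apply/funext => y; rewrite mxE.
exact/is_diff_partials/smooth_differentiable/smooth_partial.
Qed.

(** In the differential, v is the image of the position increment under the
drift; the kick adds minus h times the Hessian of phis i applied to v. *)
Lemma is_diff_split_step (phis : 'I_N -> 'rV[R]_N -> R) h i z : smooth (phis i) ->
  is_diff z (fun z => split_step phis h z i) (fun w =>
    let v := w.1 + (h * w.2 0 i) *: basis i in
    (v, w.2 - h *: \row_k \sum_l v 0 l *
      partial l (partial k (phis i)) (split_step phis h z i).1)).
Proof.
move=> sf.
have dcoord : is_diff (snd z) (fun p : 'rV[R]_N => p 0 i : R) (fun p => p 0 i).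
  by split; [exact: differentiable_coord|apply/funext => v; exact: coord_diff].
have dpi : is_diff z (fun z : phase => h * z.2 0 i) (fun w => h * w.2 0 i).
  exact: (is_diffZ h (is_diff_comp (is_diff_snd z) dcoord)).
have dkick := is_diff_comp dpi (is_diff_scalel (h * z.2 0 i) (basis i : 'rV[R]_N)).
have dx := is_diffD (is_diff_fst z) dkick.
have dg := is_diff_comp dx (is_diff_grad (split_step phis h z i).1 sf).
exact: (is_diff_pair dx (is_diffB (is_diff_snd z) (is_diffZ h dg))).
Qed.

(** Let a and b be the drifted position increments.  The kick contributes
h (Ha . b - a . Hb), zero by symmetry of the Hessian H; the drift contributes
h (r_i s_i - s_i r_i), where r and s are the two momentum increments. *)
Lemma symplectic_split_step (phis : 'I_N -> 'rV[R]_N -> R) h i : smooth (phis i) ->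
  symplectic_map (fun z => split_step phis h z i).
Proof.
move=> sf z; have [dF dFE] := is_diff_split_step h z sf; split=> // u v.
rewrite dFE /=; set x' := z.1 + _.
set a := u.1 + _; set b := v.1 + _.
have symH : \sum_k a 0 k * (\sum_l b 0 l * partial l (partial k (phis i)) x')
    = \sum_k (\sum_l a 0 l * partial l (partial k (phis i)) x') * b 0 k.
  under eq_bigr do rewrite big_distrr/=.
  under [RHS]eq_bigr do rewrite big_distrl/=.
  rewrite exchange_big/=; apply: eq_bigr => k _; apply: eq_bigr => l _.
  by rewrite (partial_sym _ _ _ sf); ring.
have dotBr x y y' : dotp x (y - h *: y') = dotp x y - h * \sum_k x 0 k * y' 0 k.
  rewrite !dotpE mulr_sumr -sumrB; apply: eq_bigr => k _.
  by rewrite !mxE; ring.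
have dotBl x x'0 y : dotp (x - h *: x'0) y = dotp x y - h * \sum_k x'0 0 k * y 0 k.
  rewrite !dotpE mulr_sumr -sumrB; apply: eq_bigr => k _.
  by rewrite !mxE; ring.
have row_sum (c : 'rV[R]_N) (g : 'I_N -> R) : \sum_k c 0 k * (\row_l g l) 0 k
    = \sum_k c 0 k * g k by apply: eq_bigr => k _; rewrite mxE.
have row_suml (c : 'rV[R]_N) (g : 'I_N -> R) : \sum_k (\row_l g l) 0 k * c 0 k
    = \sum_k g k * c 0 k by apply: eq_bigr => k _; rewrite mxE.
rewrite /sympl_form/= dotBr dotBl row_sum row_suml symH.
have dotDl x c y : dotp (x + c *: basis i) y = dotp x y + c * y 0 i.
  rewrite !dotpE (bigD1 i)//= [in RHS](bigD1 i)//= add_basisE eqxx mulr1.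
  rewrite (eq_bigr (fun k => x 0 k * y 0 k)) => [|k ki]; first by ring.
  by rewrite add_basisE (negPf ki) mulr0 addr0.
have dotC x y : dotp x y = dotp y x.
  by rewrite !dotpE; apply: eq_bigr => k _; rewrite mulrC.
rewrite [dotp u.2 b]dotC !dotDl [dotp v.1 _]dotC; ring.
Qed.

Lemma symplectic_comp (F G : phase -> phase) :
  symplectic_map F -> symplectic_map G -> symplectic_map (G \o F).
Proof.
move=> sF sG z; have [dF Fs] := sF z; have [dG Gs] := sG (F z).
split; first exact: differentiable_comp.
have E w : 'd (G \o F) z w = 'd G (F z) ('d F z w).
  exact: (congr1 (fun f => f w) (diff_comp dF dG)).
move=> u v; apply: etrans (f_equal2 sympl_form (E u) (E v)) _.
exact (etrans (Gs ('d F z u) ('d F z v)) (Fs u v)).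
Qed.

Lemma symplectic_id : symplectic_map (id : phase -> phase).
Proof.
move=> z; have [d E] := is_diff_id z; split=> // u v.
by rewrite E.
Qed.

Lemma symplectic_split_method (phis : 'I_N -> 'rV[R]_N -> R) h :
  (forall i, smooth (phis i)) -> symplectic_map (split_method phis h).
Proof.
move=> sf; rewrite /split_method; elim: (enum 'I_N) => [|i s IH].
  exact: symplectic_id.
exact: (symplectic_comp (symplectic_split_step h (sf i)) IH).
Qed.

End Symplecticity.

(** * Bounds on compact sets and quadrature of an almost constant function *)

Section Bounds.
Context {R : realType}.

Lemma continuous_bounded_on_compact (T : topologicalType) (V : normedModType R)
    (f : T -> V) (A : set T) : compact A -> {in A, continuous f} ->
  exists M : R, forall t, A t -> `|f t| <= M.
Proof.
move=> cA cf.
move/continuous_in_subspaceT : cf => /(continuous_compact)/(_ cA)/compact_bounded/ex_strict_bound_gt0 [M M0 MA].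
by exists M => t At; apply/ltW/MA; exists t.
Qed.

Lemma finite_family_bound (I : finType) (T : Type) (P : T -> Prop)
    (g : I -> T -> R) :
  (forall i, exists M, forall t, P t -> g i t <= M) ->
  exists2 M, 0 <= M & forall i t, P t -> g i t <= M.
Proof.
move=> /choice[M gM]; exists (\sum_i `|M i|); first exact: sumr_ge0.
move=> i t Pt; rewrite (le_trans (gM i t Pt))// (le_trans (ler_norm _))//.
by rewrite (bigD1 i)//= lerDl sumr_ge0.
Qed.

(** The discrete Lagrangian is constant in the integration variable, so a pointwise
estimate of the integrand suffices. *)
Lemma Rintegral_cst_dist (g : R -> R) (t h c E : R) : 0 < h ->
  (forall s, s \in `[t, t + h] -> {for s, continuous g}) ->
  (forall s, s \in `[t, t + h] -> `|c - g s| <= E) ->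
  `|h * c - \int[lebesgue_measure]_(s in `[t, t + h]) g s| <= E * h.
Proof.
move=> h0 cg gE; set D := `[t, t + h]%classic.
have integrable_cont (k : R -> R) :
    (forall s, s \in `[t, t + h] -> {for s, continuous k}) ->
    (@lebesgue_measure R).-integrable D (EFin \o k).
  move=> ck; apply: continuous_compact_integrable; first exact: segment_compact.
  by apply: continuous_in_subspaceT => s /[!inE] sD; apply: ck.
have mD : measurable (D : set (measurableTypeR R)) by exact: measurable_itv.
have int_cst (k : R) : \int[lebesgue_measure]_(s in D) k = k * h.
  rewrite Rintegral_cst//= /D lebesgue_measure_itv/= lte_fin ltrDl h0 -EFinD/=.
  by rewrite addrAC subrr add0r.
have ic k : (@lebesgue_measure R).-integrable D (EFin \o cst k).
  by apply: integrable_cont => s _; exact: cst_continuous.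
have ig := integrable_cont g cg.
have cgc s : s \in `[t, t + h] -> {for s, continuous (fun s => c - g s)}.
  by move=> sD; apply: continuousB; [exact: cst_continuous|exact: cg].
have igc := integrable_cont _ cgc.
have intB : \int[lebesgue_measure]_(s in D) (c - g s)
    = \int[lebesgue_measure]_(s in D) c - \int[lebesgue_measure]_(s in D) g s.
  exact: RintegralB mD (ic c) ig.
rewrite [h * c]mulrC -[c * h]int_cst -intB -[E * h]int_cst.
apply: le_trans (le_normr_Rintegral mD igc) _.
apply: (le_Rintegral mD _ (ic E)).
  apply: integrable_cont => s sD; apply: (continuous_comp (cgc s sD)).
  exact: norm_continuous.
by move=> s sD; apply: gE.
Qed.

Context {N : nat}.
Implicit Types (x y v : 'rV[R]_N).

Lemma norm_coord x k : `|x 0 k| <= `|x|.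
Proof.
rewrite [leRHS]/Num.Def.normr/= mx_normrE.
exact: (le_bigmax _ (fun ij : 'I_1 * 'I_N => `|x ij.1 ij.2|) (0, k)).
Qed.

Lemma norm_rV_le x (M : R) : 0 <= M -> (forall k, `|x 0 k| <= M) -> `|x| <= M.
Proof.
move=> M0 xM; rewrite /Num.Def.normr/= mx_normrE bigmax_le//= => -[i k] _ /=.
by rewrite ord1.
Qed.

Lemma compact_closed_ball_rV (M : R) : compact [set y : 'rV[R]_N | `|y| <= M].
Proof.
apply: bounded_closed_compact.
  by exists M; split; [exact: num_real|move=> r Mr y /= /le_trans; apply; exact: ltW].
apply: (@preimage_closed _ _ (fun y : 'rV[R]_N => `|y|) [set r | r <= M]).
  by move=> y _; exact: norm_continuous.
exact: closed_le.
Qed.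

(** Mean value theorem on the segment from z to y, which stays in the ball, with
the partial derivatives bounded by compactness. *)
Lemma smooth_lipschitz_on_ball (f : 'rV[R]_N -> R) (M : R) : smooth f ->
  exists2 K, 0 <= K & forall y z, `|y| <= M -> `|z| <= M ->
    `|f y - f z| <= K * `|y - z|.
Proof.
move=> sf.
have [D D0 fD] : exists2 D, 0 <= D &
    forall i y, `|y| <= M -> `|partial i f y| <= D.
  apply: finite_family_bound => i.
  apply: (continuous_bounded_on_compact (@compact_closed_ball_rV M)) => y _.
  exact: (smooth_continuous (smooth_partial _ sf)).
exists (D *+ N); first exact: mulrn_wge0.
move=> y z yM zM.
have dg (t : R) : is_derive t 1 (fun t => f (z + t *: (y - z)))
    ('D_(y - z) f (z + t *: (y - z))).
  apply/is_derive_lineP/derivableP/diff_derivable.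
  exact: smooth_differentiable.
have cg : {within `[0, 1], continuous (fun t : R => f (z + t *: (y - z)))}.
  apply: continuous_subspaceT => t.
  by apply/differentiable_continuous/derivable1_diffP; case: (dg t).
have [t] := MVT ltr01 (fun t _ => dg t) cg.
rewrite in_itv/= => /andP[t0 t1].
rewrite scale1r scale0r addr0 subrKC subr0 mulr1 => ->.
set w := z + _.
have wM : `|w| <= M.
  have -> : w = (1 - t) *: z + t *: y.
    by rewrite /w scalerBr scalerBl scale1r addrA addrAC.
  apply: (le_trans (ler_normD _ _)); rewrite !normrZ !gtr0_norm ?subr_gt0//; nra.
rewrite derive_partials; last exact: smooth_differentiable.
apply: (le_trans (ler_norm_sum _ _ _)).
have -> : D *+ N * `|y - z| = \sum_(k < N) `|y - z| * D.
  by rewrite sumr_const card_ord mulrnAl mulrC.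
by apply: ler_sum => k _; rewrite normrM ler_pM// ?norm_coord// fD.
Qed.

End Bounds.

(** * The discrete Lagrangian has order one *)

Section OrderOne.
Context {R : realType} {N : nat}.
Implicit Types (x : R -> 'rV[R]_N) (a b s t h : R).

Lemma is_derive_coord x s k : derivable x s 1 ->
  is_derive s 1 (fun s => x s 0 k) ((x^`())%classic s 0 k).
Proof.
move=> dx; have /derivable_mxP/(_ 0 k)/derivableP := dx.
by rewrite derive1E (derive_mx dx) mxE.
Qed.

(** For curves in several dimensions the mean value equality fails: the
intermediate time depends on the component, which is why the estimates below are
made component by component. *)
Lemma coord_mean_value x a b k : a < b ->
  (forall r, a <= r <= b -> derivable x r 1) ->
  exists2 r, a < r < b &
    x b 0 k - x a 0 k = (x^`())%classic r 0 k * (b - a).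
Proof.
move=> ab dx.
have dk r : r \in `]a, b[ ->
    is_derive r 1 (fun s => x s 0 k) ((x^`())%classic r 0 k).
  by rewrite in_itv/= => /andP[? ?]; apply/is_derive_coord/dx/andP; split; apply/ltW.
have ck : {within `[a, b], continuous (fun s => x s 0 k)}.
  apply: continuous_in_subspaceT => r; rewrite inE/= in_itv/= => rab.
  apply/differentiable_continuous/derivable1_diffP.
  by have [] := is_derive_coord k (dx r rab).
by have [r] := MVT ab dk ck; rewrite in_itv/= => rab E; exists r.
Qed.

Lemma coord_lipschitz x a b (M : R) s t k :
  (forall r, a <= r <= b -> derivable x r 1) ->
  (forall r, a <= r <= b -> `|(x^`())%classic r| <= M) ->
  a <= s <= b -> a <= t <= b -> `|x t 0 k - x s 0 k| <= M * `|t - s|.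
Proof.
move=> dx xM; wlog st : s t / s < t => [H|] sab tab.
  have [st|ts|->] := ltgtP s t; first exact: H.
    by rewrite distrC [`|t - s|]distrC; exact: H.
  by rewrite !subrr !normr0 mulr0.
have sub r : s <= r <= t -> a <= r <= b by move: sab tab; lra.
have [|r rst ->] := @coord_mean_value x s t k st.
  by move=> r /sub; exact: dx.
rewrite normrM ler_wpM2r// (le_trans (norm_coord _ _))// xM// sub//.
by move: rst; lra.
Qed.

Variables (phi : 'rV[R]_N -> R) (phis : 'I_N -> 'rV[R]_N -> R).
Hypothesis phis_smooth : forall i, smooth (phis i).
Hypothesis phi_split : forall y, phi y = \sum_i phis i y.

Lemma continuous_lagrangian x s : derivable x s 1 -> derivable (x^`())%classic s 1 ->
  {for s, continuous (fun s => lagrangian phi (x s) ((x^`())%classic s))}.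
Proof.
move=> dx ddx.
have cphi y : {for y, continuous phi}.
  rewrite (_ : phi = \sum_i phis i); last first.
    by apply/funext => z; rewrite phi_split fct_sumE.
  apply/differentiable_continuous/differentiable_sum => i.
  exact: smooth_differentiable.
have cdot : {for s, continuous
    (fun s => dotp ((x^`())%classic s) ((x^`())%classic s))}.
  rewrite (_ : (fun s => _) =
    (\sum_k ((fun s => (x^`())%classic s 0 k) * (fun s => (x^`())%classic s 0 k)))).
    apply/differentiable_continuous/differentiable_sum => k.
    by apply: differentiableM; apply/derivable1_diffP;
      have [] := is_derive_coord k ddx.
  by apply/funext => r; rewrite dotpE fct_sumE.
apply: continuousB.
  by apply: continuousM; [exact: cst_continuous|exact: cdot].
apply: (@continuous_comp _ _ _ x phi); last exact: cphi.
exact: (differentiable_continuous (iffLR (derivable1_diffP x s) dx)).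
Qed.

(** Kinetic part: component k of the difference quotient is x'_k at some time of
[t, t + h], thus within M h of x'_k (s), and v^2 - u^2 = (v + u) (v - u) with
|v + u| <= 2 M; half the sum over the components is at most N M^2 h.  Potential
part: each component of xhat is a component of x t or of x (t + h), thus within
M h of that of x s, and each of the N potentials is K-Lipschitz. *)
Lemma discrete_lagrangian_pointwise x a b (M K : R) : 0 <= M -> 0 <= K ->
  (forall r, a <= r <= b -> derivable x r 1) ->
  (forall r, a <= r <= b -> derivable (x^`())%classic r 1) ->
  (forall r, a <= r <= b -> `|x r| <= M) ->
  (forall r, a <= r <= b -> `|(x^`())%classic r| <= M) ->
  (forall r, a <= r <= b -> `|(x^`()^`())%classic r| <= M) ->
  (forall i y z, `|y| <= M -> `|z| <= M -> `|phis i y - phis i z| <= K * `|y - z|) ->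
  forall t h s, a <= t -> 0 < h -> t + h <= b -> t <= s <= t + h ->
  `|L1st phis (x t) (x (t + h)) h - lagrangian phi (x s) ((x^`())%classic s)|
    <= ((M * M + K * M) * N%:R) * h.
Proof.
move=> M0 K0 dx ddx xM dxM ddxM phiK t h s at_ h0 thb sth.
have sub r : t <= r <= t + h -> a <= r <= b by move: at_ thb; lra.
have tt : t <= t <= t + h by lra.
have thth : t <= t + h <= t + h by lra.
have kin : `|2^-1 * (dotp (x (t + h) - x t) (x (t + h) - x t) / h ^+ 2)
    - 2^-1 * dotp ((x^`())%classic s) ((x^`())%classic s)| <= (M * M * N%:R) * h.
  have -> : 2^-1 * (dotp (x (t + h) - x t) (x (t + h) - x t) / h ^+ 2)
      - 2^-1 * dotp ((x^`())%classic s) ((x^`())%classic s)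
      = \sum_k 2^-1 * (((x (t + h) 0 k - x t 0 k) / h) ^+ 2
                       - (x^`())%classic s 0 k ^+ 2).
    rewrite !dotpE mulr_suml !mulr_sumr -sumrB; apply: eq_bigr => k _.
    by rewrite !mxE; field; rewrite gt_eqF.
  apply: (le_trans (ler_norm_sum _ _ _)).
  have -> : (M * M * N%:R) * h = \sum_(k < N) M * M * h.
    by rewrite sumr_const card_ord -mulr_natr; ring.
  apply: ler_sum => k _.
  have [||r rth ->] := @coord_mean_value x t (t + h) k; first by rewrite ltrDl.
    by move=> r /sub; exact: dx.
  have rth' : t <= r <= t + h by move: rth; lra.
  rewrite (_ : t + h - t = h); last by ring.
  rewrite mulfK ?gt_eqF//.
  have := coord_lipschitz k ddx ddxM (sub _ sth) (sub _ rth').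
  have := le_trans (norm_coord _ k) (dxM r (sub _ rth')).
  have := le_trans (norm_coord _ k) (dxM s (sub _ sth)).
  move: ((x^`())%classic s 0 k) ((x^`())%classic r 0 k) => u v uM vM uv.
  have rs : `|r - s| <= h by move: rth sth; rewrite ler_norml; lra.
  rewrite (_ : 2^-1 * (v ^+ 2 - u ^+ 2) = 2^-1 * (v + u) * (v - u)); last by ring.
  rewrite normrM -[M * M * h]mulrA ler_pM//.
    rewrite normrM gtr0_norm ?invr_gt0//.
    by have := ler_normD v u; lra.
  by apply: (le_trans uv); rewrite ler_wpM2l.
have pot : `|\sum_i phis i (xhat (x t) (x (t + h)) i) - phi (x s)|
    <= (K * M * N%:R) * h.
  rewrite phi_split -sumrB; apply: (le_trans (ler_norm_sum _ _ _)).
  have -> : (K * M * N%:R) * h = \sum_(k < N) K * (M * h).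
    by rewrite sumr_const card_ord -mulr_natr; ring.
  apply: ler_sum => i _; apply: (le_trans (phiK i _ _ _ _)).
  - apply: norm_rV_le => // k; rewrite xhatE.
    by case: ifP => _; apply: (le_trans (norm_coord _ _)); apply/xM/sub.
  - exact/xM/sub.
  rewrite ler_wpM2l//; apply: norm_rV_le => [|k].
    by rewrite mulr_ge0// ltW.
  rewrite mxE [X in _ + X]mxE xhatE.
  have lip r : t <= r <= t + h -> `|x r 0 k - x s 0 k| <= M * h.
    move=> rth; apply: (le_trans (coord_lipschitz k dx dxM (sub _ sth) (sub _ rth))).
    by rewrite ler_wpM2l// ler_norml; move: rth sth; lra.
  by case: ifP => _; apply: lip.
rewrite /L1st /lagrangian.
move: kin pot; set k1 := 2^-1 * (_ / _); set k2 := 2^-1 * _; set p1 := \sum_i _.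
rewrite !ler_norml => /andP[? ?] /andP[? ?]; apply/andP; split; nra.
Qed.

Lemma L1st_order_one : discrete_lagrangian_order phi (L1st phis) 1.
Proof.
move=> T0 T1 x sol a b T0a ab bT1.
(* Halving the distance to T1 keeps [t, t + h] in the compact interval [a, b']
   of the domain of the solution, for all t <= b and h <= h0. *)
pose h0 := (T1 - b) / 2; pose b' := b + h0.
have h00 : 0 < h0 by rewrite /h0; lra.
have b'T : b' < T1 by rewrite /b' /h0; lra.
have dx n r : a <= r <= b' -> derivable (x^`(n))%classic r 1.
  move=> rab; have [|| + _] := sol r; [by lra|by lra|exact].
have bound n : exists M, forall r, a <= r <= b' -> `|(x^`(n))%classic r| <= M.
  have [||M xM] := @continuous_bounded_on_compact R R _ (x^`(n))%classic `[a, b'].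
  - exact: segment_compact.
  - move=> r; rewrite inE/= in_itv/= => rab.
    exact/differentiable_continuous/derivable1_diffP/dx.
  - by exists M => r rab; apply: xM; rewrite /= in_itv.
have [M M0 xM] : exists2 M, 0 <= M & forall (n : 'I_3) r, a <= r <= b' ->
    `|(x^`(n))%classic r| <= M.
  by apply: finite_family_bound => n; exact: bound.
have [K K0 phiK] : exists2 K, 0 <= K & forall i y z, `|y| <= M -> `|z| <= M ->
    `|phis i y - phis i z| <= K * `|y - z|.
  have /choice[K HK] : forall i, exists K, 0 <= K /\ forall y z, `|y| <= M ->
      `|z| <= M -> `|phis i y - phis i z| <= K * `|y - z|.
    by move=> i; have [K ? ?] := smooth_lipschitz_on_ball M (phis_smooth i); exists K.
  exists (\sum_i K i); first by apply: sumr_ge0 => i _; case: (HK i).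
  move=> i y z yM zM; have [Ki lip] := HK i.
  apply: (le_trans (lip y z yM zM)); rewrite ler_wpM2r// (bigD1 i)//= lerDl.
  by apply: sumr_ge0 => j _; case: (HK j).
exists ((M * M + K * M) * N%:R), h0; split=> // t h at_ tb hp hh0.
have thb' : t + h <= b' by rewrite /b'; lra.
rewrite expr2 mulrA; apply: Rintegral_cst_dist => // s; rewrite in_itv/= => sth.
  have sab : a <= s <= b' by move: sth; lra.
  by apply: continuous_lagrangian; [exact: (dx 0%N)|exact: (dx 1%N)].
apply: (@discrete_lagrangian_pointwise x a b' M K) => //.
- by move=> r; exact: (dx 0%N).
- by move=> r; exact: (dx 1%N).
- exact: (xM (@Ordinal 3 0 isT)).
- exact: (xM (@Ordinal 3 1 isT)).
- exact: (xM (@Ordinal 3 2 isT)).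
Qed.

End OrderOne.

(** * Order, equations of motion and symplectic form of the integrator *)

Theorem theorem3p3 (R : realType) (N : nat) (phi : 'rV[R]_N -> R)
    (phis : 'I_N -> 'rV[R]_N -> R)
    (phis_smooth : forall i, smooth (phis i))
    (phi_split : forall x, phi x = \sum_(i < N) phis i x) :
  [/\ discrete_lagrangian_order phi (L1st phis) 1,
      forall (h : R) (xm x xp : 'rV[R]_N), h != 0 ->
        (discrete_euler_lagrange (L1st phis) h xm x xp <->
          (forall i : 'I_N, i = 0%N :> nat ->
            (xp 0 i - 2 * x 0 i + xm 0 i) / h ^+ 2
            = - \sum_(j < N) partial i (phis j) (xhat xm x j)) /\
          (forall i : 'I_N, (0 < i)%N ->
            (xp 0 i - 2 * x 0 i + xm 0 i) / h ^+ 2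
            = - (\sum_(j < N | (j < i)%N) partial i (phis j) (xhat x xp j)
                 + \sum_(j < N | (i <= j)%N)
                     partial i (phis j) (xhat xm x j)))),
      forall h : R, h != 0 ->
        equivalent_one_step (L1st phis) h (split_method phis h),
      forall (h : R) (i : 'I_N) (z z' : 'rV[R]_N * 'rV[R]_N),
        symplectic_euler (Hsplit phis i) h z z' <-> z' = split_step phis h z i
    & forall h : R, symplectic_map (split_method phis h)].
Proof.
have phis_diff i x : differentiable (phis i) x by exact: smooth_differentiable.
split.
- exact: L1st_order_one.
- move=> h xm x xp _; rewrite (discrete_euler_lagrangeP phis_diff).
  have first_sums (i : 'I_N) : i = 0%N :> nat ->
      \sum_(j < N | (j < i)%N) partial i (phis j) (xhat x xp j)
      + \sum_(j < N | (i <= j)%N) partial i (phis j) (xhat xm x j)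
      = \sum_(j < N) partial i (phis j) (xhat xm x j).
    by move=> i0; rewrite i0 big_pred0// add0r.
  split=> [E|[E0 Epos] i]; first by split=> i i0; rewrite E// first_sums.
  have [i0|] := posnP i; last exact: Epos.
  by rewrite first_sums// E0.
- by move=> h h0; exact: split_method_equivalent.
- by move=> h i z z'; exact: symplectic_eulerP.
- by move=> h; exact: symplectic_split_method.
Qed.
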